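(* Let $t_0, r\in\mathbb{R}$ with $r>0$ and let $I:=[t_0,t_0+r]$. Suppose that $f:I\times I\times\mathbb{R}\to\mathbb{R}$ is a continuous function satisfying the Lipschitz condition $$|f(t,s,z_1)-f(t,s,z_2)|\leq L|z_1-z_2|$$ for all $t,s\in I$, all $z_1,z_2\in\mathbb{R}$ and some $L>0$. Let $\varphi:I\to(0,\infty)$ be a nondecreasing continuous function, and let $\eta$ be an arbitrary fixed real number with $\eta>L$. If a continuous function $y:I\to\mathbb{R}$ satisfies $$\left|y(t)-\int_{t_0}^{t}f(t,s,y(s))\,ds\right|\leq\varphi(t)$$ for all $t\in I$, then there exists a unique solution $y_0:I\to\mathbb{R}$ of the Volterra integral equation $$y_0(t)=\int_{t_0}^{t}f(t,s,y_0(s))\,ds,\qquad t\in I,$$ satisfying $$|y(t)-y_0(t)|\leq\frac{\varphi(t)\,e^{\eta r}}{1-L/\eta}$$ for all $t\in I$.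
   Context: A solution of the Volterra integral equation on $I$ is a continuous function $y_0:I\to\mathbb{R}$ satisfying the equation for every $t\in I$. *)

(* Defs.v *)
From Stdlib Require Import Reals.
From Coquelicot Require Import Coquelicot.
Open Scope R_scope.

Definition Icc (a b x : R) : Prop := a <= x <= b.

(** A function on [I] (resp. [I * I * R]) is represented by a total function
    of which only the values at points of [I] (resp. [I * I * R]) matter. *)

(** Joint continuity on [[a,b] * [a,b] * R], for the subspace topology. *)
Definition kernel_continuous (a b : R) (f : R -> R -> R -> R) : Prop :=
  continuous_on
    (fun p : R * R * R => Icc a b (fst (fst p)) /\ Icc a b (snd (fst p)))
    (fun p : R * R * R => f (fst (fst p)) (snd (fst p)) (snd p)).

(** [RInt] is a total operator, but the integrand below is continuous on
    [[a,t]] as soon as [f] and [y] are continuous, so that it is then the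
    actual Riemann integral. *)
Definition volterra_op (a : R) (f : R -> R -> R -> R) (y : R -> R) (t : R) : R :=
  RInt (fun s => f t s (y s)) a t.

Definition volterra_solution (a b : R) (f : R -> R -> R -> R) (y : R -> R) : Prop :=
  continuous_on (Icc a b) y /\
  forall t, Icc a b t -> y t = volterra_op a f y t.

(* Main.v *)
(** Extending [f] and [y] constantly outside the interval turns them into
    continuous functions on the whole line.  With [T g t] the integral of
    [f t s (g s)] over [[t0,t]], the operator [T] contracts by [q = L / eta < 1]
    for the weight [phi t * exp (eta * (t - t0))], since [phi] is nondecreasing.
    Hence the Picard iterates from [y] move by at most [q ^ n] times the weight at
    step [n]; their uniform limit is a solution at distance at most
    [1 / (1 - q)] times the weight from [y].  Two solutions at bounded distance
    coincide by the same contraction. *)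

Require Import Defs.
From Stdlib Require Import Reals Lra Lia.
From Coquelicot Require Import Coquelicot.
Open Scope R_scope.

(** * Clamping to an interval and continuous extension *)

Definition clamp (a b t : R) : R := Rmax a (Rmin b t).

Lemma clamp_Icc (a b t : R) : a <= b -> Icc a b (clamp a b t).
Proof.
  unfold clamp, Icc, Rmax, Rmin; intros hab.
  destruct (Rle_dec b t); destruct Rle_dec; lra.
Qed.

Lemma clamp_id (a b t : R) : Icc a b t -> clamp a b t = t.
Proof.
  unfold clamp, Icc, Rmax, Rmin; intros hab.
  destruct (Rle_dec b t); destruct Rle_dec; lra.
Qed.

Lemma clamp_lipschitz (a b s t : R) :
  Rabs (clamp a b s - clamp a b t) <= Rabs (s - t).
Proof.
  unfold clamp, Rmax, Rmin.
  destruct (Rle_dec b s); destruct (Rle_dec b t);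
    repeat destruct Rle_dec; unfold Rabs; repeat destruct Rcase_abs; lra.
Qed.

Lemma continuous_clamp (a b t : R) : continuous (clamp a b) t.
Proof.
  apply filterlim_locally; intros eps; exists eps; intros s hs.
  apply Rle_lt_trans with (2 := hs), clamp_lipschitz.
Qed.

(** Continuity on [D] only controls [f] along points of [D]. Since [c] takes all its values in [D],
    the restriction disappears after pulling back along [c]. With [c] a clamp, this turns subspace
    continuity into continuity on the whole space. *)
Lemma continuous_comp_retraction {U V : UniformSpace} (D : U -> Prop)
  (c : U -> U) (f : U -> V) (x : U) :
  (forall u, D (c u)) -> continuous c x -> continuous_on D f ->
  continuous (fun u => f (c u)) x.
Proof.
  intros hD hc hf.
  apply filterlim_comp with (2 := hf (c x) (hD x)).
  intros P hP.
  assert (h : locally x (fun u => D (c u) -> P (c u))) by exact (hc _ hP).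
  change (locally x (fun u => P (c u))).
  apply filter_imp with (2 := h); intros u hu; exact (hu (hD u)).
Qed.

Lemma continuous_pair {U V W : UniformSpace} (g : U -> V) (h : U -> W) (x : U) :
  continuous g x -> continuous h x -> continuous (fun u => (g u, h u)) x.
Proof.
  intros hg hh.
  apply (continuous_comp_2 g h pair x hg hh).
  apply continuous_ext with (f := fun p => p); [now intros []|].
  apply continuous_id.
Qed.

Definition extend_kernel (a b : R) (f : R -> R -> R -> R) (t s z : R) : R :=
  f (clamp a b t) (clamp a b s) z.

Lemma continuous_extend_kernel (a b : R) (f : R -> R -> R -> R) (p : R * R * R) :
  a <= b -> kernel_continuous a b f ->
  continuous (fun q : R * R * R =>
    extend_kernel a b f (fst (fst q)) (snd (fst q)) (snd q)) p.
Proof.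
  intros hab hf.
  apply (continuous_comp_retraction
    (U := prod_UniformSpace (prod_UniformSpace R_UniformSpace R_UniformSpace)
            R_UniformSpace) _
    (fun q : R * R * R =>
       ((clamp a b (fst (fst q)), clamp a b (snd (fst q))), snd q)) _ p) with (3 := hf).
  - now intros u; split; apply clamp_Icc.
  - apply continuous_pair; [|destruct p; apply continuous_snd].
    destruct p as [[t s] z].
    apply continuous_pair;
      (apply continuous_comp; [|apply continuous_clamp]);
      (apply continuous_comp; [apply continuous_fst|]).
    + apply continuous_fst.
    + apply continuous_snd.
Qed.

Lemma continuous_kernel_comp {U : UniformSpace} (F : R -> R -> R -> R)
  (t s z : U -> R) (u : U) :
  (forall p : R * R * R,
     continuous (fun q : R * R * R => F (fst (fst q)) (snd (fst q)) (snd q)) p) ->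
  continuous t u -> continuous s u -> continuous z u ->
  continuous (fun v => F (t v) (s v) (z v)) u.
Proof.
  intros hF ht hs hz.
  apply (continuous_comp (fun v => ((t v, s v), z v))
    (fun q : R * R * R => F (fst (fst q)) (snd (fst q)) (snd q))); [|apply hF].
  now repeat apply continuous_pair.
Qed.

(** * Sequences with geometrically decreasing steps *)

Lemma is_lim_seq_scal_geom (K q : R) :
  0 <= q < 1 -> is_lim_seq (fun n => K * q ^ n) 0.
Proof.
  intros hq.
  replace (Finite 0) with (Rbar_mult K 0) by (simpl; f_equal; ring).
  apply is_lim_seq_scal_l, is_lim_seq_geom; rewrite Rabs_pos_eq; lra.
Qed.

(** Telescoping the steps from [n] on gives a geometric tail, so [u] is Cauchy; the estimate then
    passes to the limit. [Lim_seq] is total, so it can later define the limit function at every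
    point. *)
Lemma geometric_steps_limit (u : nat -> R) (K q : R) :
  0 <= q < 1 -> (forall n, Rabs (u (S n) - u n) <= K * q ^ n) ->
  forall n, Rabs (u n - real (Lim_seq u)) <= K / (1 - q) * q ^ n.
Proof.
  intros hq hu.
  assert (hK : 0 <= K).
  { generalize (hu 0%nat) (Rabs_pos (u 1%nat - u 0%nat)); simpl; lra. }
  assert (htail : forall n p, Rabs (u (n + p)%nat - u n) <= K / (1 - q) * q ^ n).
  (* The factor [1 - q ^ p] comes from the exact partial geometric sum; the plain bound
     [K / (1 - q) * q ^ n] would not survive the induction on [p]. *)
  { assert (h : forall n p,
      Rabs (u (n + p)%nat - u n) <= K / (1 - q) * q ^ n * (1 - q ^ p)).
    { intros n p; induction p as [|p IH].
      - rewrite Nat.add_0_r; simpl.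
        rewrite Rminus_diag, Rabs_R0; lra.
      - rewrite Nat.add_succ_r.
        replace (u (S (n + p)) - u n)
          with ((u (S (n + p)) - u (n + p)%nat) + (u (n + p)%nat - u n)) by ring.
        eapply Rle_trans; [apply Rabs_triang|].
        generalize (hu (n + p)%nat); rewrite pow_add; intros h1.
        replace (K / (1 - q) * q ^ n * (1 - q ^ S p)) with
          (K * (q ^ n * q ^ p) + K / (1 - q) * q ^ n * (1 - q ^ p))
          by (simpl; field; lra).
        lra. }
    intros n p; eapply Rle_trans; [apply h|].
    rewrite <- Rmult_1_r; apply Rmult_le_compat_l.
    - apply Rmult_le_pos; [apply Rdiv_le_0_compat; lra|apply pow_le; lra].
    - generalize (pow_le q p (proj1 hq)); lra. }
  assert (hex : ex_finite_lim_seq u).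
  { apply ex_lim_seq_cauchy_corr; intros eps.
    destruct (proj2 (is_lim_seq_spec _ _) (is_lim_seq_scal_geom (K / (1 - q)) q hq) (pos_div_2 eps)) as [N hN].
    exists N; intros n m hn hm.
    specialize (hN N (le_n _)); rewrite Rminus_0_r in hN; apply Rabs_def2 in hN.
    simpl in hN.
    generalize (htail N (n - N)%nat) (htail N (m - N)%nat).
    replace (N + (n - N))%nat with n by lia.
    replace (N + (m - N))%nat with m by lia.
    intros h1 h2; apply Rabs_le_between in h1; apply Rabs_le_between in h2.
    apply Rabs_def1; lra. }
  intros n.
  apply Lim_seq_correct' in hex.
  rewrite Rabs_minus_sym.
  (* Let [p] tend to infinity in [htail] with [n] fixed. *)
  apply (is_lim_seq_le (fun p => Rabs (u (p + n)%nat - u n))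
           (fun _ => K / (1 - q) * q ^ n)
           (Rabs (real (Lim_seq u) - u n)) (K / (1 - q) * q ^ n)).
  - intros p; rewrite Nat.add_comm; apply htail.
  - apply (is_lim_seq_abs _ (real (Lim_seq u) - u n)).
    apply is_lim_seq_minus'; [|apply is_lim_seq_const].
    now apply (is_lim_seq_incr_n u n).
  - apply is_lim_seq_const.
Qed.

(** * Continuity and contraction of the Volterra operator *)

(** Compactness of the segment [[a,b]] gives one [delta] that serves all [s] at once, so the
    integrands are uniformly close when [t] is near [x]. *)
Lemma continuous_RInt_param (h : R -> R -> R) (a b x : R) :
  a <= b ->
  (forall t s, continuous (fun q : R * R => h (fst q) (snd q)) (t, s)) ->
  continuous (fun t => RInt (h t) a b) x.
Proof.
  intros hab hh.
  assert (hex : forall t, ex_RInt (h t) a b).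
  { intros t; apply (ex_RInt_continuous (V := R_CompleteNormedModule)); intros s _.
    apply (continuous_comp_2 (fun _ => t) (fun s => s) h s
             (continuous_const _ _) (continuous_id _) (hh t s)). }
  apply filterlim_locally; intros eps.
  (* Adding 1 to the length avoids dividing by zero when [a = b] and makes the final inequality
     strict. *)
  assert (heps : 0 < eps / (b - a + 1)).
  { apply Rdiv_lt_0_compat; [apply cond_pos|lra]. }
  destruct (uniform_continuity_2d_1d' h a b x) with (eps := mkposreal _ heps)
    as [delta hdelta].
  { intros s _; apply continuity_2d_pt_filterlim, (hh x s). }
  exists delta; intros t ht.
  change (Rabs (RInt (h t) a b - RInt (h x) a b) < eps).
  change (Rabs (t - x) < delta) in ht; apply Rabs_def2 in ht.
  change (Rabs (minus (RInt (h t) a b) (RInt (h x) a b)) < eps).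
  rewrite <- RInt_minus by apply hex.
  apply Rle_lt_trans with ((b - a) * (eps / (b - a + 1))).
  - apply abs_RInt_le_const; [exact hab|now apply ex_RInt_minus|].
    intros s hs; apply Rlt_le.
    apply (hdelta s x s t); try lra.
    rewrite Rminus_diag, Rabs_R0; apply cond_pos.
  - apply Rlt_le_trans with ((b - a + 1) * (eps / (b - a + 1))).
    + apply Rmult_lt_compat_r; lra.
    + right; field; lra.
Qed.

(* The substitution [s = a + u * (t - a)] makes the bounds of integration
   independent of [t]. *)
Lemma continuous_volterra_op (a : R) (F : R -> R -> R -> R) (g : R -> R) (t : R) :
  (forall p : R * R * R,
     continuous (fun q : R * R * R => F (fst (fst q)) (snd (fst q)) (snd q)) p) ->
  (forall s, continuous g s) ->
  continuous (volterra_op a F g) t.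
Proof.
  intros hF hg.
  apply continuous_ext with (fun x => RInt (fun u =>
    (x - a) * F x ((x - a) * u + a) (g ((x - a) * u + a))) 0 1).
  { intros x; unfold volterra_op.
    replace (RInt (fun s => F x s (g s)) a x) with
      (RInt (fun s => F x s (g s)) ((x - a) * 0 + a) ((x - a) * 1 + a))
      by (f_equal; ring).
    apply (RInt_comp_lin (V := R_CompleteNormedModule) (fun s => F x s (g s))).
    apply (ex_RInt_continuous (V := R_CompleteNormedModule)); intros s _.
    apply continuous_kernel_comp; auto using continuous_const, continuous_id. }
  apply (continuous_RInt_param (fun x u =>
    (x - a) * F x ((x - a) * u + a) (g ((x - a) * u + a)))); [lra|intros x u].
  assert (hx : continuous (fun q : R * R => fst q - a) (x, u)).
  { apply (continuous_minus (V := R_NormedModule) fst (fun _ => a));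
      [apply continuous_fst|apply continuous_const]. }
  assert (hs : continuous (fun q : R * R => (fst q - a) * snd q + a) (x, u)).
  { apply (continuous_plus (V := R_NormedModule) (fun q : R * R => (fst q - a) * snd q)
             (fun _ => a)); [|apply continuous_const].
    apply (continuous_mult (K := R_AbsRing) (fun q : R * R => fst q - a) snd);
      [exact hx|apply continuous_snd]. }
  apply (continuous_mult (K := R_AbsRing) (fun q : R * R => fst q - a)); [exact hx|].
  apply continuous_kernel_comp; [exact hF|apply continuous_fst|exact hs|].
  apply (continuous_comp (fun q : R * R => (fst q - a) * snd q + a) g); auto.
Qed.

(* Contraction for the Bielecki norm: integrating [L * exp (eta * (s - a))]
   costs a factor [L / eta]. *)
Lemma volterra_op_contraction (a t L eta C : R) (F : R -> R -> R -> R) (g h : R -> R) :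
  (forall p : R * R * R,
     continuous (fun q : R * R * R => F (fst (fst q)) (snd (fst q)) (snd q)) p) ->
  (forall s z1 z2, Rabs (F t s z1 - F t s z2) <= L * Rabs (z1 - z2)) ->
  (forall s, continuous g s) -> (forall s, continuous h s) ->
  0 <= L -> 0 < eta -> 0 <= C -> a <= t ->
  (forall s, a <= s <= t -> Rabs (g s - h s) <= C * exp (eta * (s - a))) ->
  Rabs (volterra_op a F g t - volterra_op a F h t)
    <= L / eta * C * exp (eta * (t - a)).
Proof.
  intros hF hLip hg hh hL heta hC hat hgh.
  assert (hex : forall k, (forall s, continuous k s) ->
    ex_RInt (fun s => F t s (k s)) a t).
  { intros k hk; apply (ex_RInt_continuous (V := R_CompleteNormedModule)); intros s _.
    apply continuous_kernel_comp; auto using continuous_const, continuous_id. }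
  assert (hE : forall s : R, is_derive (fun s => L / eta * C * exp (eta * (s - a))) s
    (L * C * exp (eta * (s - a)))).
  { intros s; auto_derive; [exact I|unfold Rminus; field; lra]. }
  (* The middle term is the integral of [L * C * exp (eta * (s - a))] over [[a,t]], computed from
     its primitive; the nonnegative contribution of the endpoint [a] is then dropped. *)
  apply Rle_trans with
    (L / eta * C * exp (eta * (t - a)) - L / eta * C * exp (eta * (a - a))).
  - unfold volterra_op.
    apply (norm_RInt_le (V := R_NormedModule)
      (fun s => minus (F t s (g s)) (F t s (h s)))
      (fun s => L * C * exp (eta * (s - a))) a t); [exact hat| | |].
    + intros s hs.
      apply Rle_trans with (1 := hLip s (g s) (h s)).
      rewrite Rmult_assoc; apply Rmult_le_compat_l; auto.
    + apply (is_RInt_minus (V := R_NormedModule));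
        apply (RInt_correct (V := R_CompleteNormedModule)); auto.
    + apply (is_RInt_derive (V := R_CompleteNormedModule)
        (fun s => L / eta * C * exp (eta * (s - a)))); intros s _; [apply hE|].
      apply (ex_derive_continuous (V := R_NormedModule)).
      now auto_derive.
  - enough (0 <= L / eta * C * exp (eta * (a - a))) by lra.
    apply Rmult_le_pos; [|apply Rlt_le, exp_pos].
    apply Rmult_le_pos; [|exact hC].
    now apply Rdiv_le_0_compat.
Qed.

(** * Consequences of geometric bounds *)

Lemma continuous_uniform_limit (u : nat -> R -> R) (l : R -> R) (K q x : R) :
  0 <= q < 1 -> (forall n t, continuous (u n) t) ->
  (forall n t, Rabs (u n t - l t) <= K * q ^ n) -> continuous l x.
Proof.
  intros hq hu hl.
  apply continuity_pt_filterlim.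
  apply (CVU_continuity u l x (mkposreal 1 Rlt_0_1)).
  - intros eps heps.
    destruct (proj2 (is_lim_seq_spec _ _) (is_lim_seq_scal_geom K q hq) (mkposreal eps heps)) as [N hN].
    exists N; intros n t hn _.
    specialize (hN n hn); rewrite Rminus_0_r in hN.
    rewrite Rabs_minus_sym.
    apply Rle_lt_trans with (1 := hl n t).
    apply Rle_lt_trans with (1 := Rle_abs _); exact hN.
  - intros n t _; apply continuity_pt_filterlim, hu.
  - apply Boule_center.
Qed.

Lemma eq_of_geometric_bound (x y K q : R) :
  0 <= q < 1 -> (forall n, Rabs (x - y) <= K * q ^ n) -> x = y.
Proof.
  intros hq h.
  assert (h0 : Rabs (x - y) <= 0).
  { apply (is_lim_seq_le _ _ (Rabs (x - y)) 0 h); [apply is_lim_seq_const|now apply is_lim_seq_scal_geom]. }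
  apply Rminus_diag_uniq, Rabs_eq_0, Rle_antisym; [exact h0|apply Rabs_pos].
Qed.

Lemma exp_le_compat (x y : R) : x <= y -> exp x <= exp y.
Proof. now intros [h | ->]; [left; apply exp_increasing|right]. Qed.

(** * Uniqueness and existence for a kernel defined on the whole line *)

(** The difference of two solutions equals the difference of their images, so each use of the
    contraction improves its bound by [L / eta]. The bound [K] starts the iteration, the weight
    being at least 1. *)
Lemma volterra_solution_unique (a b L eta K : R) (F : R -> R -> R -> R) (g h : R -> R) :
  (forall p : R * R * R,
     continuous (fun q : R * R * R => F (fst (fst q)) (snd (fst q)) (snd q)) p) ->
  (forall t s z1 z2, Rabs (F t s z1 - F t s z2) <= L * Rabs (z1 - z2)) ->
  (forall s, continuous g s) -> (forall s, continuous h s) ->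
  0 < L < eta ->
  (forall t, Icc a b t -> g t = volterra_op a F g t) ->
  (forall t, Icc a b t -> h t = volterra_op a F h t) ->
  (forall t, Icc a b t -> Rabs (g t - h t) <= K) ->
  forall t, Icc a b t -> g t = h t.
Proof.
  intros hF hLip hg hh hL hgV hhV hK.
  assert (hq : 0 <= L / eta < 1).
  { split; [apply Rdiv_le_0_compat; lra|apply Rlt_div_l; lra]. }
  assert (hn : forall n t, Icc a b t ->
    Rabs (g t - h t) <= K * (L / eta) ^ n * exp (eta * (t - a))).
  { induction n as [|n IH]; intros t ht.
    - generalize (hK t ht) (Rabs_pos (g t - h t)); intros h1 h2.
      apply Rle_trans with (1 := h1).
      rewrite pow_O, Rmult_1_r, <- (Rmult_1_r K) at 1.
      apply Rmult_le_compat_l; [lra|].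
      rewrite <- exp_0; apply exp_le_compat.
      apply Rmult_le_pos; unfold Icc in ht; lra.
    - rewrite (hgV t ht), (hhV t ht).
      replace (K * (L / eta) ^ S n) with (L / eta * (K * (L / eta) ^ n))
        by (simpl; ring).
      apply volterra_op_contraction; auto; try (unfold Icc in ht; lra).
      + generalize (hK t ht) (Rabs_pos (g t - h t)); intros h1 h2.
        apply Rmult_le_pos; [lra|apply pow_le; lra].
      + intros s hs; apply IH; unfold Icc in *; lra. }
  intros t ht.
  apply (eq_of_geometric_bound _ _ (K * exp (eta * (t - a))) (L / eta) hq).
  intros n; eapply Rle_trans; [apply (hn n t ht)|right; ring].
Qed.

Lemma volterra_solution_near (a b L eta : R) (F : R -> R -> R -> R) (phi y : R -> R) :
  a <= b ->
  (forall p : R * R * R,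
     continuous (fun q : R * R * R => F (fst (fst q)) (snd (fst q)) (snd q)) p) ->
  (forall t s z1 z2, Rabs (F t s z1 - F t s z2) <= L * Rabs (z1 - z2)) ->
  0 < L < eta ->
  (forall s t, Icc a b s -> Icc a b t -> s <= t -> phi s <= phi t) ->
  (forall t, continuous y t) ->
  (forall t, Icc a b t -> Rabs (y t - volterra_op a F y t) <= phi t) ->
  exists y0 : R -> R,
    (forall t, continuous y0 t) /\
    (forall t, Icc a b t -> y0 t = volterra_op a F y0 t) /\
    (forall t, Icc a b t ->
       Rabs (y t - y0 t) <= phi t * exp (eta * (t - a)) / (1 - L / eta)).
Proof.
  intros hab hF hLip hL hmono hyc hy.
  set (q := L / eta).
  assert (hq : 0 <= q < 1).
  { unfold q; split; [apply Rdiv_le_0_compat; lra|apply Rlt_div_l; lra]. }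
  assert (hphi : forall t, Icc a b t -> 0 <= phi t).
  { intros t ht; apply Rle_trans with (2 := hy t ht), Rabs_pos. }
  set (u := fun n => Nat.iter n (volterra_op a F) y).
  assert (huc : forall n t, continuous (u n) t).
  { induction n as [|n IH]; intros t; [apply hyc|now apply continuous_volterra_op]. }
  assert (hstep : forall n t, Icc a b t ->
    Rabs (u (S n) t - u n t) <= phi t * q ^ n * exp (eta * (t - a))).
  { induction n as [|n IH]; intros t ht.
    - rewrite Rabs_minus_sym; apply Rle_trans with (1 := hy t ht).
      rewrite pow_O, Rmult_1_r, <- (Rmult_1_r (phi t)) at 1.
      apply Rmult_le_compat_l; [now apply hphi|].
      rewrite <- exp_0; apply exp_le_compat.
      apply Rmult_le_pos; unfold Icc in ht; lra.
    - replace (phi t * q ^ S n) with (L / eta * (phi t * q ^ n))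
        by (unfold q; simpl; ring).
      (* The contraction constant is frozen at the outer endpoint: [C = phi t * q ^ n]. Monotonicity
         of [phi] lets it dominate the bound at every [s <= t]. *)
      apply (volterra_op_contraction a t L eta _ F (u (S n)) (u n)); auto;
        try (unfold Icc in ht; lra).
      + apply Rmult_le_pos; [now apply hphi|apply pow_le; lra].
      + intros s hs.
        assert (hsI : Icc a b s) by (unfold Icc in *; lra).
        apply Rle_trans with (1 := IH s hsI).
        apply Rmult_le_compat_r; [apply Rlt_le, exp_pos|].
        apply Rmult_le_compat_r; [apply pow_le; lra|].
        apply hmono; [exact hsI|exact ht|apply hs]. }
  set (l := fun t => real (Lim_seq (fun n => u n t))).
  assert (hl : forall n t, Icc a b t ->
    Rabs (u n t - l t) <= phi t / (1 - q) * q ^ n * exp (eta * (t - a))).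
  { intros n t ht.
    replace (phi t / (1 - q) * q ^ n * exp (eta * (t - a)))
      with (phi t * exp (eta * (t - a)) / (1 - q) * q ^ n) by (field; lra).
    apply (geometric_steps_limit (fun n => u n t)); [exact hq|].
    intros m; eapply Rle_trans; [apply (hstep m t ht)|right; ring]. }
  (* The limit is controlled only on [[a,b]]; clamping its argument makes the convergence uniform,
     hence the limit continuous, on the whole line. *)
  set (y0 := fun t => l (clamp a b t)).
  assert (hy0 : forall t, Icc a b t -> y0 t = l t).
  { intros t ht; unfold y0; now rewrite clamp_id. }
  assert (hy0c : forall t, continuous y0 t).
  { intros t.
    (* Both [phi] and the exponential are largest at [b], which gives a constant independent of the
       point. *)
    apply (continuous_uniform_limit (fun n s => u n (clamp a b s)) y0
      (phi b / (1 - q) * exp (eta * (b - a))) q t hq).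
    - intros n s; apply continuous_comp; [apply continuous_clamp|apply huc].
    - intros n s.
      assert (hs := clamp_Icc a b s hab).
      apply Rle_trans with (1 := hl n _ hs).
      rewrite Rmult_assoc, (Rmult_comm (q ^ n)), <- Rmult_assoc.
      apply Rmult_le_compat_r; [apply pow_le; lra|].
      apply Rmult_le_compat.
      + apply Rdiv_le_0_compat; [now apply hphi|lra].
      + apply Rlt_le, exp_pos.
      + apply Rmult_le_compat_r; [apply Rlt_le, Rinv_0_lt_compat; lra|].
        apply hmono; [exact hs|unfold Icc; lra|apply hs].
      + apply exp_le_compat, Rmult_le_compat_l; unfold Icc in hs; lra. }
  exists y0; repeat split; [exact hy0c| |].
  - intros t ht.
    (* Compare both sides with [u (S n)], which is by definition the image of [u n]. One [q] comes
       from the error of [u (S n)], the other from contracting the error of [u n]. *)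
    apply (eq_of_geometric_bound _ _
      (2 * q * (phi t / (1 - q) * exp (eta * (t - a)))) q hq).
    intros n.
    replace (y0 t - volterra_op a F y0 t) with
      (- (u (S n) t - y0 t) + (volterra_op a F (u n) t - volterra_op a F y0 t))
      by (simpl; ring).
    eapply Rle_trans; [apply Rabs_triang|rewrite Rabs_Ropp].
    replace (2 * q * (phi t / (1 - q) * exp (eta * (t - a))) * q ^ n) with
      (phi t / (1 - q) * q ^ S n * exp (eta * (t - a)) +
       q * (phi t / (1 - q) * q ^ n) * exp (eta * (t - a))) by (simpl; ring).
    apply Rplus_le_compat; [rewrite hy0; auto|].
    apply volterra_op_contraction; auto; try (unfold Icc in ht; lra).
    + apply Rmult_le_pos; [|apply pow_le; lra].
      apply Rdiv_le_0_compat; [now apply hphi|lra].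
    + intros s hs.
      assert (hsI : Icc a b s) by (unfold Icc in *; lra).
      rewrite hy0 by exact hsI.
      apply Rle_trans with (1 := hl n s hsI).
      apply Rmult_le_compat_r; [apply Rlt_le, exp_pos|].
      apply Rmult_le_compat_r; [apply pow_le; lra|].
      apply Rmult_le_compat_r; [apply Rlt_le, Rinv_0_lt_compat; lra|].
      apply hmono; [exact hsI|exact ht|apply hs].
  (* This is the case [n = 0] of [hl], since the iteration starts at [y]. *)
  - intros t ht; rewrite hy0 by exact ht.
    eapply Rle_trans; [apply (hl 0%nat t ht)|right; simpl; field; lra].
Qed.

(** * Return to the interval *)

(** For [t] in [[a,b]] the integration variable stays in [[a,b]], where clamping is the identity.
    Equations and estimates thus transfer between the extended data and the original ones. *)
Lemma volterra_op_extend (a b : R) (f : R -> R -> R -> R) (g h : R -> R) (t : R) :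
  (forall s, Icc a b s -> g s = h s) -> Icc a b t ->
  volterra_op a (extend_kernel a b f) g t = volterra_op a f h t.
Proof.
  intros hgh ht; apply RInt_ext; unfold Icc in ht.
  rewrite Rmin_left, Rmax_right by lra; intros s hs.
  assert (hsI : Icc a b s) by (unfold Icc; lra).
  unfold extend_kernel; rewrite !clamp_id, hgh; auto.
Qed.

Theorem theorem2p7 (t0 r : R) (hr : 0 < r)
  (f : R -> R -> R -> R) (L : R) (hL : 0 < L)
  (hf : kernel_continuous t0 (t0 + r) f)
  (hLip : forall t s z1 z2 : R,
      Icc t0 (t0 + r) t -> Icc t0 (t0 + r) s ->
      Rabs (f t s z1 - f t s z2) <= L * Rabs (z1 - z2))
  (phi : R -> R)
  (hphi_cont : continuous_on (Icc t0 (t0 + r)) phi)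
  (hphi_pos : forall t : R, Icc t0 (t0 + r) t -> 0 < phi t)
  (hphi_mono : forall s t : R,
      Icc t0 (t0 + r) s -> Icc t0 (t0 + r) t -> s <= t -> phi s <= phi t)
  (eta : R) (heta : L < eta)
  (y : R -> R)
  (hy_cont : continuous_on (Icc t0 (t0 + r)) y)
  (hy : forall t : R, Icc t0 (t0 + r) t ->
      Rabs (y t - volterra_op t0 f y t) <= phi t) :
  exists y0 : R -> R,
    (volterra_solution t0 (t0 + r) f y0 /\
     forall t : R, Icc t0 (t0 + r) t ->
       Rabs (y t - y0 t) <= phi t * exp (eta * r) / (1 - L / eta)) /\
    forall y1 : R -> R,
      (volterra_solution t0 (t0 + r) f y1 /\
       forall t : R, Icc t0 (t0 + r) t ->
         Rabs (y t - y1 t) <= phi t * exp (eta * r) / (1 - L / eta)) ->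
      forall t : R, Icc t0 (t0 + r) t -> y1 t = y0 t.
Proof.
  assert (hab : t0 <= t0 + r) by lra.
  set (b := t0 + r) in *; set (F := extend_kernel t0 b f).
  set (c := clamp t0 b).
  assert (hF : forall p : R * R * R,
    continuous (fun q : R * R * R => F (fst (fst q)) (snd (fst q)) (snd q)) p).
  { intros p; now apply continuous_extend_kernel. }
  assert (hFL : forall t s z1 z2, Rabs (F t s z1 - F t s z2) <= L * Rabs (z1 - z2)).
  { intros t s z1 z2; apply hLip; now apply clamp_Icc. }
  assert (hext : forall g : R -> R, continuous_on (Icc t0 b) g ->
    forall t, continuous (fun s => g (c s)) t).
  { intros g hg t; apply (continuous_comp_retraction (Icc t0 b) c g t);
      [|apply continuous_clamp|exact hg].
    intros s; now apply clamp_Icc. }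
  assert (hc : forall (g : R -> R) t, Icc t0 b t -> g (c t) = g t).
  { intros g t ht; unfold c; now rewrite clamp_id. }
  assert (hq : 0 < 1 - L / eta).
  { apply Rlt_0_minus, Rlt_div_l; lra. }
  destruct (volterra_solution_near t0 b L eta F phi (fun t => y (c t)))
    as [y0 [hy0c [hy0 hnear]]]; auto.
  { intros t ht; unfold F; rewrite (volterra_op_extend t0 b f _ y); auto.
    rewrite hc; auto. }
  assert (hy0near : forall t, Icc t0 b t ->
    Rabs (y t - y0 t) <= phi t * exp (eta * r) / (1 - L / eta)).
  { intros t ht; rewrite <- (hc y t ht).
    apply Rle_trans with (1 := hnear t ht).
    (* The sharper weight [exp (eta * (t - t0))] is at most [exp (eta * r)] because
       [t - t0 <= r]. *)
    apply Rmult_le_compat_r; [now apply Rlt_le, Rinv_0_lt_compat|].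
    apply Rmult_le_compat_l; [now apply Rlt_le, hphi_pos|].
    apply exp_le_compat, Rmult_le_compat_l; unfold Icc, b in ht; lra. }
  exists y0; repeat split.
  - now apply continuous_on_forall; intros.
  - intros t ht; rewrite hy0 by exact ht; now apply volterra_op_extend.
  - exact hy0near.
  - intros y1 [[hy1c hy1] hnear1] t ht; rewrite <- (hc y1 t ht).
    (* The a priori bound is the triangle inequality through [y]: each solution is within the stated
       distance of [y], and [phi b] is the largest value of [phi]. *)
    apply (volterra_solution_unique t0 b L eta
      (2 * (phi b * exp (eta * r) / (1 - L / eta))) F
      (fun s => y1 (c s)) y0); auto.
    + intros s hs; rewrite hc, hy1 by exact hs.
      symmetry; apply volterra_op_extend; auto.
    + intros s hs; rewrite hc by exact hs.
      assert (hM : phi s * exp (eta * r) / (1 - L / eta)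
                   <= phi b * exp (eta * r) / (1 - L / eta)).
      { apply Rmult_le_compat_r; [now apply Rlt_le, Rinv_0_lt_compat|].
        apply Rmult_le_compat_r; [apply Rlt_le, exp_pos|].
        apply hphi_mono; [exact hs|unfold Icc; lra|apply hs]. }
      replace (y1 s - y0 s) with (- (y s - y1 s) + (y s - y0 s)) by ring.
      eapply Rle_trans; [apply Rabs_triang|rewrite Rabs_Ropp].
      generalize (hnear1 s hs) (hy0near s hs); lra.
Qed.
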